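(* The quotient group $B_7/[P_7,P_7]$ possesses a subgroup isomorphic to the Frobenius group $\mathcal{F}$ of order $21$.
   Context: $B_7$ is the Artin braid group with generators $\sigma_1,\ldots,\sigma_6$ and relations $\sigma_i\sigma_j=\sigma_j\sigma_i$ for $|i-j|\geq 2$, and $\sigma_{i+1}\sigma_i\sigma_{i+1}=\sigma_i\sigma_{i+1}\sigma_i$ for $1\leq i\leq 5$. $P_7$ is the pure braid group, i.e. the kernel of the homomorphism $\sigma\colon B_7\to S_7$ with $\sigma(\sigma_i)=(i,i+1)$, and $[P_7,P_7]$ is its commutator subgroup. The Frobenius group of order $21$ is $\mathcal{F}=\langle s,t \mid s^3=t^7=1,\ sts^{-1}=t^2\rangle$. *)

(* Defs.v *)
From HB Require Import structures.
From mathcomp Require Import all_boot perm all_classical.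
From mathcomp Require Import zify.
From mathcomp Require Import generic_quotient.

Set Implicit Arguments.
Unset Strict Implicit.
Unset Printing Implicit Defensive.

Local Open Scope classical_set_scope.
Local Open Scope group_scope.
Local Open Scope quotient_scope.

Section Words.
Variable X : choiceType.

(* A letter (x, true) stands for the generator x, (x, false) for its inverse. *)
Definition word := seq (X * bool).

Definition gen (x : X) : X * bool := (x, true).
Definition geni (x : X) : X * bool := (x, false).
Definition flip (l : X * bool) : X * bool := (l.1, ~~ l.2).

Definition winv (w : word) : word := rev (map flip w).

Lemma winvK : involutive winv.
Proof.
by move=> w; rewrite /winv map_rev revK -map_comp map_id_in // => -[x []].
Qed.

Variable R : word -> word -> Prop.

(* The least congruence on words containing R and the free cancellations, so
   that the classes of words form the group < X | u = v for R u v >. *)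
Inductive pres_eq : word -> word -> Prop :=
| pres_rel u v of R u v : pres_eq u v
| pres_cancel l : pres_eq [:: l; flip l] [::]
| pres_cat u u' v v' of pres_eq u u' & pres_eq v v' :
    pres_eq (u ++ v) (u' ++ v')
| pres_refl u : pres_eq u u
| pres_sym u v of pres_eq u v : pres_eq v u
| pres_trans v u w of pres_eq u v & pres_eq v w : pres_eq u w.

Definition pres_eqb (u v : word) : bool := `[< pres_eq u v >].

Lemma pres_eqb_refl : reflexive pres_eqb.
Proof. by move=> u; apply/asboolP; exact: pres_refl. Qed.

Lemma pres_eqb_sym : symmetric pres_eqb.
Proof. by move=> u v; apply/asboolP/asboolP; exact: pres_sym. Qed.

Lemma pres_eqb_trans : transitive pres_eqb.
Proof.
by move=> v u w /asboolP uv /asboolP vw; apply/asboolP; exact: pres_trans vw.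
Qed.

Canonical pres_equiv := EquivRel pres_eqb pres_eqb_refl pres_eqb_sym
  pres_eqb_trans.

Definition presented := {eq_quot pres_equiv}.

HB.instance Definition _ := Choice.on presented.
HB.instance Definition _ := EqQuotient.on presented.

Definition pclass (w : word) : presented := \pi_presented w.

Lemma pclassP u v : pclass u = pclass v <-> pres_eq u v.
Proof.
rewrite /pclass; split=> [/eqP|uv]; first by rewrite piE => /asboolP.
by apply/eqP; rewrite piE; apply/asboolP.
Qed.

Lemma pclass_repr (a : presented) : pclass (repr a) = a.
Proof. exact: reprK. Qed.

Lemma repr_pclass u : pres_eq (repr (pclass u)) u.
Proof. by apply/pclassP; rewrite pclass_repr. Qed.

Lemma pres_eq_winvl w : pres_eq (winv w ++ w) [::].
Proof.
elim: w => [|l w IH]; first exact: pres_refl.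
rewrite /winv /= rev_cons -cats1 -catA /=.
apply: pres_trans IH; apply: pres_cat; first exact: pres_refl.
rewrite -[X in pres_eq _ X]cat0s; apply: (@pres_cat [:: flip l; l]).
  2: exact: pres_refl.
by case: l => x b; have := pres_cancel (x, ~~ b); rewrite /flip /= negbK.
Qed.

Lemma pres_eq_winvr w : pres_eq (w ++ winv w) [::].
Proof. by have := pres_eq_winvl (winv w); rewrite winvK. Qed.

Lemma pres_eq_winv u v : pres_eq u v -> pres_eq (winv u) (winv v).
Proof.
move=> uv.
have h1 : pres_eq (winv u ++ v ++ winv v) (winv u).
  rewrite -[X in pres_eq _ X]cats0.
  by apply: pres_cat (pres_eq_winvr v); exact: pres_refl.
apply: (pres_trans (pres_sym h1)); rewrite catA -[X in pres_eq _ X]cat0s.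
apply: pres_cat; last exact: pres_refl.
apply: pres_trans (pres_eq_winvl u); apply: pres_cat; first exact: pres_refl.
exact: pres_sym.
Qed.

Definition pres_one : presented := pclass [::].
Definition pres_mul (a b : presented) : presented := pclass (repr a ++ repr b).
Definition pres_inv (a : presented) : presented := pclass (winv (repr a)).

Lemma pres_mulE u v : pres_mul (pclass u) (pclass v) = pclass (u ++ v).
Proof. by apply/pclassP/pres_cat; exact: repr_pclass. Qed.

Lemma pres_invE u : pres_inv (pclass u) = pclass (winv u).
Proof. by apply/pclassP/pres_eq_winv; exact: repr_pclass. Qed.

Lemma pres_mulA : associative pres_mul.
Proof.
move=> a b c; rewrite -(pclass_repr a) -(pclass_repr b) -(pclass_repr c).
by rewrite !pres_mulE catA.
Qed.

Lemma pres_mul1g : left_id pres_one pres_mul.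
Proof. by move=> a; rewrite -(pclass_repr a) pres_mulE cat0s. Qed.

Lemma pres_mulg1 : right_id pres_one pres_mul.
Proof. by move=> a; rewrite -(pclass_repr a) pres_mulE cats0. Qed.

Lemma pres_mulVg : left_inverse pres_one pres_inv pres_mul.
Proof.
move=> a; rewrite -(pclass_repr a) pres_invE pres_mulE.
exact/pclassP/pres_eq_winvl.
Qed.

Lemma pres_mulgV : right_inverse pres_one pres_inv pres_mul.
Proof.
move=> a; rewrite -(pclass_repr a) pres_invE pres_mulE.
exact/pclassP/pres_eq_winvr.
Qed.

HB.instance Definition _ := isGroup.Build presented
  pres_mulA pres_mul1g pres_mulg1 pres_mulVg pres_mulgV.

Definition pgen (x : X) : presented := pclass [:: gen x].

Lemma pclassM u v : pclass (u ++ v) = pclass u * pclass v.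
Proof. by rewrite -pres_mulE. Qed.

Lemma pclass_nil : pclass [::] = 1.
Proof. by []. Qed.

Lemma pclass_geni x : pclass [:: geni x] = (pgen x)^-1.
Proof. by rewrite [RHS]pres_invE. Qed.

Section UniversalProperty.
Variables (G : groupType) (f : X -> G).

Definition eval_letter (l : X * bool) : G := if l.2 then f l.1 else (f l.1)^-1.

Definition eval_word (w : word) : G := \prod_(l <- w) eval_letter l.

Lemma eval_word_cat u v : eval_word (u ++ v) = eval_word u * eval_word v.
Proof. exact: big_cat. Qed.

Hypothesis fR : forall u v, R u v -> eval_word u = eval_word v.

Lemma eval_word_pres u v : pres_eq u v -> eval_word u = eval_word v.
Proof.
elim=> {u v} //.
- move=> [x b]; rewrite /eval_word !big_cons big_nil mulg1 /eval_letter /=.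
  by case: b; rewrite /= (mulgV, mulVg).
- by move=> u u' v v' _ uu' _ vv'; rewrite !eval_word_cat uu' vv'.
- by move=> v u w _ -> _ ->.
Qed.

Definition pres_hom (_ : forall u v, R u v -> eval_word u = eval_word v)
  (a : presented) : G := eval_word (repr a).

Lemma pres_hom_pclass u : pres_hom fR (pclass u) = eval_word u.
Proof. by apply: eval_word_pres; exact: repr_pclass. Qed.

Lemma pres_hom_gen x : pres_hom fR (pgen x) = f x.
Proof. by rewrite pres_hom_pclass /eval_word big_seq1. Qed.

Lemma pres_hom_morph : {morph pres_hom fR : a b / a * b}.
Proof.
move=> a b; rewrite -(pclass_repr a) -(pclass_repr b) -pclassM.
by rewrite !pres_hom_pclass eval_word_cat.
Qed.

End UniversalProperty.

Lemma pclassE w : pclass w = eval_word pgen w.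
Proof.
elim: w => [|[x b] w IH]; first by rewrite /eval_word big_nil.
rewrite -cat1s pclassM IH eval_word_cat; congr (_ * _).
by rewrite /eval_word big_seq1 /eval_letter; case: b; rewrite //= -pclass_geni.
Qed.

Lemma pres_gen_rel u v : R u v -> eval_word pgen u = eval_word pgen v.
Proof. by move=> uv; rewrite -!pclassE; apply/pclassP/pres_rel. Qed.

End Words.

Section Subgroups.
Variable G : groupType.
Implicit Types A H N : set G.

Definition is_subgroup H : Prop :=
  [/\ H 1, (forall x y, H x -> H y -> H (x * y)) & (forall x, H x -> H x^-1)].

(* Conjugation is x ^ g = g^-1 * x * g. *)
Definition is_normal N : Prop := forall x g, N x -> N (x ^ g).

Definition generated A : set G :=
  [set x | forall H, is_subgroup H -> A `<=` H -> H x].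

Lemma generated_subgroup A : is_subgroup (generated A).
Proof.
split=> [H [] //|x y Ax Ay H Hg AH|x Ax H Hg AH]; case: (Hg) => _ HM HV.
  by apply: HM; [exact: Ax|exact: Ay].
by apply: HV; exact: Ax.
Qed.

Lemma sub_generated A : A `<=` generated A.
Proof. by move=> x Ax H _; exact. Qed.

Definition derived H : set G :=
  generated [set [~ x, y] | x in H & y in H].

Lemma derived_normal N : is_normal N -> is_normal (derived N).
Proof.
move=> nN x g Dx H Hg AH.
pose K : set G := [set y | H (y ^ g)].
apply: (Dx K) => [|_ [y Ny [z Nz <-]]]; last first.
  rewrite /K /= conjRg; apply: AH.
  by exists (y ^ g); [exact: nN|exists (z ^ g); [exact: nN|]].
case: (Hg) => H1 HM HV; rewrite /K; split => /= [|y z Hy Hz|y Hy].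
- by rewrite conj1g.
- by rewrite conjMg; exact: HM.
- by rewrite conjVg; exact: HV.
Qed.

Record normalSubgroup := NormalSubgroup {
  nsub :> set G;
  nsub_subgroup : is_subgroup nsub;
  nsub_normal : is_normal nsub
}.

End Subgroups.

Section QuotientGroup.
Variables (G : groupType) (N : normalSubgroup G).

Definition coset_rel (x y : G) : bool := `[< nsub N (x^-1 * y) >].

Lemma coset_rel_refl : reflexive coset_rel.
Proof.
by move=> x; apply/asboolP; rewrite mulVg; case: (nsub_subgroup N).
Qed.

Lemma coset_rel_sym : symmetric coset_rel.
Proof.
have h x y : coset_rel x y -> coset_rel y x.
  move=> /asboolP Nxy; apply/asboolP; case: (nsub_subgroup N) => _ _ /(_ _ Nxy).
  by rewrite invgM invgK.
by move=> x y; apply/idP/idP; exact: h.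
Qed.

Lemma coset_rel_trans : transitive coset_rel.
Proof.
move=> y x z /asboolP xy /asboolP yz; apply/asboolP.
case: (nsub_subgroup N) => _ /(_ _ _ xy yz) + _.
by rewrite -mulgA mulVKg.
Qed.

Canonical coset_equiv := EquivRel coset_rel coset_rel_refl coset_rel_sym
  coset_rel_trans.

Definition quot := {eq_quot coset_equiv}.

HB.instance Definition _ := Choice.on quot.
HB.instance Definition _ := EqQuotient.on quot.

Definition qclass (x : G) : quot := \pi_quot x.

Lemma qclassP x y : qclass x = qclass y <-> nsub N (x^-1 * y).
Proof.
rewrite /qclass; split=> [/eqP|xy]; first by rewrite piE => /asboolP.
by apply/eqP; rewrite piE; apply/asboolP.
Qed.

Lemma qclass_repr (a : quot) : qclass (repr a) = a.
Proof. exact: reprK. Qed.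

Definition quot_one : quot := qclass 1.
Definition quot_mul (a b : quot) : quot := qclass (repr a * repr b).
Definition quot_inv (a : quot) : quot := qclass (repr a)^-1.

Lemma repr_qclass x : nsub N ((repr (qclass x))^-1 * x).
Proof. by apply/qclassP; rewrite qclass_repr. Qed.

Lemma quot_mulE x y : quot_mul (qclass x) (qclass y) = qclass (x * y).
Proof.
apply/qclassP; have := repr_qclass y; have := repr_qclass x.
set x' := repr _; set y' := repr _ => Nx Ny.
rewrite (_ : _ * _ = (x'^-1 * x) ^ y' * (y'^-1 * y)); last first.
  by rewrite /conjg invgM !mulgA mulgK.
case: (nsub_subgroup N) => _ NM _; apply: NM Ny; exact: nsub_normal Nx.
Qed.

Lemma quot_invE x : quot_inv (qclass x) = qclass x^-1.
Proof.
apply/qclassP; have := repr_qclass x; set x' := repr _ => Nx.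
case: (nsub_subgroup N) => _ _ NV.
rewrite (_ : _ * _ = ((x'^-1 * x)^-1) ^ x^-1); last first.
  by rewrite /conjg invgM !invgK -!mulgA mulVKg.
by apply: nsub_normal; exact: NV.
Qed.

Lemma quot_mulA : associative quot_mul.
Proof.
move=> a b c; rewrite -(qclass_repr a) -(qclass_repr b) -(qclass_repr c).
by rewrite !quot_mulE mulgA.
Qed.

Lemma quot_mul1g : left_id quot_one quot_mul.
Proof. by move=> a; rewrite -(qclass_repr a) quot_mulE mul1g. Qed.

Lemma quot_mulg1 : right_id quot_one quot_mul.
Proof. by move=> a; rewrite -(qclass_repr a) quot_mulE mulg1. Qed.

Lemma quot_mulVg : left_inverse quot_one quot_inv quot_mul.
Proof. by move=> a; rewrite -(qclass_repr a) quot_invE quot_mulE mulVg. Qed.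

Lemma quot_mulgV : right_inverse quot_one quot_inv quot_mul.
Proof. by move=> a; rewrite -(qclass_repr a) quot_invE quot_mulE mulgV. Qed.

HB.instance Definition _ := isGroup.Build quot
  quot_mulA quot_mul1g quot_mulg1 quot_mulVg quot_mulgV.

Lemma qclassM x y : qclass (x * y) = qclass x * qclass y.
Proof. by rewrite -quot_mulE. Qed.

End QuotientGroup.

Definition isomorphic_to (G F : groupType) (H : set G) : Prop :=
  exists2 f : F -> G, {morph f : x y / x * y} & set_bij [set: F] H f.

Section Braids.
Variable n : nat.

(* Indices start at 0: the generator i : 'I_n.-1 is the classical
   sigma_(i+1), and it exchanges the points i and i+1 of 'I_n. *)
Inductive braid_rel : word 'I_n.-1 -> word 'I_n.-1 -> Prop :=
| braid_far (i j : 'I_n.-1) of (i.+1 < j) || (j.+1 < i) :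
    braid_rel [:: gen i; gen j] [:: gen j; gen i]
| braid_near (i j : 'I_n.-1) of j = i.+1 :> nat :
    braid_rel [:: gen j; gen i; gen j] [:: gen i; gen j; gen i].

Definition braid_group := presented braid_rel.

HB.instance Definition _ := Group.on braid_group.

Definition braid_gen (i : 'I_n.-1) : braid_group := pgen braid_rel i.

Lemma strand_subproof (i : 'I_n.-1) : i.+1 < n.
Proof. by case: i => i /=; case: n. Qed.

Definition strand_lo (i : 'I_n.-1) : 'I_n := Ordinal (ltnW (strand_subproof i)).
Definition strand_hi (i : 'I_n.-1) : 'I_n := Ordinal (strand_subproof i).

Definition braid_transp (i : 'I_n.-1) : {perm 'I_n} :=
  tperm (strand_lo i) (strand_hi i).

Lemma braid_transp_rel u v :
  braid_rel u v -> eval_word braid_transp u = eval_word braid_transp v.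
Proof.
have tJ (i j : 'I_n.-1) : braid_transp j * (braid_transp i * braid_transp j) =
    tperm (braid_transp j (strand_lo i)) (braid_transp j (strand_hi i)).
  by rewrite -tpermJ /conjg tpermV.
case=> i j ij; rewrite /eval_word !big_cons big_nil /eval_letter /= !mulg1.
- apply: (mulgI (braid_transp j)); rewrite tJ mulgA [X in X * _]tperm2 mul1g.
  by rewrite !tpermD // -val_eqE /=; lia.
- have E : strand_hi i = strand_lo j by apply: val_inj; rewrite /= ij.
  rewrite !tJ -E /braid_transp tpermR !(E, tpermL) -E; congr (tperm _ _).
    by rewrite tpermD // -val_eqE /=; lia.
  by rewrite tpermD // -val_eqE /=; lia.
Qed.

(* Permutations compose from left to right here; since each transposition is
   its own inverse, the opposite convention would give a homomorphism with the
   same kernel. *)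
Definition braid_perm : braid_group -> {perm 'I_n} :=
  pres_hom braid_transp_rel.

Lemma braid_perm_gen i : braid_perm (braid_gen i) = braid_transp i.
Proof. exact: pres_hom_gen. Qed.

Lemma braid_permM : {morph braid_perm : a b / a * b}.
Proof. exact: pres_hom_morph. Qed.

Lemma braid_perm1 : braid_perm 1 = 1.
Proof. by apply: (mulgI (braid_perm 1)); rewrite -braid_permM !mulg1. Qed.

Lemma braid_permV a : braid_perm a^-1 = (braid_perm a)^-1.
Proof.
by apply: (mulgI (braid_perm a)); rewrite -braid_permM !mulgV braid_perm1.
Qed.

Definition pure_braid : set braid_group := [set a | braid_perm a = 1].

Lemma pure_braid_subgroup : is_subgroup pure_braid.
Proof.
split=> [|x y Px Py|x Px] /=; first exact: braid_perm1.
  by rewrite /pure_braid /= braid_permM Px Py mulg1.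
by rewrite /pure_braid /= braid_permV Px invg1.
Qed.

Lemma pure_braid_normal : is_normal pure_braid.
Proof.
move=> x g Px; rewrite /pure_braid /= /conjg !braid_permM Px mul1g.
by rewrite braid_permV mulVg.
Qed.

(* [P_n, P_n] as a normal subgroup of B_n. *)
Definition derived_pure_braid : normalSubgroup braid_group :=
  @NormalSubgroup braid_group (derived pure_braid)
    (generated_subgroup _) (derived_normal pure_braid_normal).

End Braids.

Definition frob_s : bool := true.
Definition frob_t : bool := false.

Inductive frobenius_rel : word bool -> word bool -> Prop :=
| frob_s3 : frobenius_rel (nseq 3 (gen frob_s)) [::]
| frob_t7 : frobenius_rel (nseq 7 (gen frob_t)) [::]
| frob_sts : frobenius_rel [:: gen frob_s; gen frob_t; geni frob_s]
                           (nseq 2 (gen frob_t)).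

Definition frobenius21 := presented frobenius_rel.

HB.instance Definition _ := Group.on frobenius21.

Section FrobeniusOrder.
Let s : frobenius21 := pgen frobenius_rel frob_s.
Let t : frobenius21 := pgen frobenius_rel frob_t.

Lemma frobenius21_s3 : s ^+ 3 = 1.
Proof.
have := pres_gen_rel frob_s3.
by rewrite /eval_word /= !big_cons big_nil !mulg1.
Qed.

Lemma frobenius21_t7 : t ^+ 7 = 1.
Proof.
have := pres_gen_rel frob_t7.
by rewrite /eval_word /= !big_cons big_nil !mulg1.
Qed.

Lemma frobenius21_sts : s * t * s^-1 = t ^+ 2.
Proof.
have := pres_gen_rel frob_sts.
by rewrite /eval_word /= !big_cons big_nil !mulg1 mulgA.
Qed.

Let nf (k : 'I_7 * 'I_3) : frobenius21 := t ^+ k.1 * s ^+ k.2.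

Lemma nf_mulM (j i : nat) : exists k, t ^+ j * s ^+ i = nf k.
Proof.
exists (inord (j %% 7), inord (i %% 3)); rewrite /nf /= !inordK ?ltn_mod //.
rewrite {1}(divn_eq j 7) {1}(divn_eq i 3) !expgnDr.
by rewrite !(mulnC (_ %/ _)) !expgnA frobenius21_s3 frobenius21_t7 !expg1n !mul1g.
Qed.

Lemma st_comm j : s * t ^+ j = t ^+ (2 * j) * s.
Proof.
rewrite expgnA -frobenius21_sts; elim: j => [|j IH]; first by rewrite !expg0 mulg1 mul1g.
by rewrite [t ^+ _]expgSr [LHS]mulgA IH [in RHS]expgSr -!mulgA mulVg mulg1.
Qed.

Lemma nf_surj a : exists k, a = nf k.
Proof.
rewrite -(pclass_repr a); elim: (repr a) => [|l w [[j i] IH]].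
  by exists (ord0, ord0); rewrite /nf !expg0 mulg1.
have hs (b : frobenius21) : (exists k, b = nf k) -> exists k, s * b = nf k.
  move=> [[j' i'] ->]; rewrite /nf /= mulgA st_comm -mulgA -expgS.
  exact: nf_mulM.
have ht (b : frobenius21) : (exists k, b = nf k) -> exists k, t * b = nf k.
  move=> [[j' i'] ->]; rewrite /nf /= mulgA -expgS.
  exact: nf_mulM.
have ex : exists k, pclass frobenius_rel w = nf k by exists (j, i).
have sV : s^-1 = s * s.
  by apply: (mulgI s); rewrite mulgV -frobenius21_s3 !expgS expg0 mulg1.
have tV : t^-1 = t * (t * (t * (t * (t * t)))).
  by apply: (mulgI t); rewrite mulgV -frobenius21_t7 !expgS expg0 mulg1.
rewrite -cat1s pclassM; case: l => [[] []].
- exact: hs.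
- by rewrite pclass_geni -/s sV -mulgA; do 2!apply: (hs).
- exact: ht.
- by rewrite pclass_geni -/t tV -!mulgA; do 6!apply: (ht).
Qed.

Let ps_fun (a : 'I_7) : 'I_7 := inord (a * 4 %% 7).
Let pt_fun (a : 'I_7) : 'I_7 := inord (a.+1 %% 7).
Lemma ps_inj : injective ps_fun.
Proof.
move=> a b /(congr1 val); rewrite /= !inordK ?ltn_mod // => E.
by apply: val_inj => /=; have := ltn_ord a; have := ltn_ord b; lia.
Qed.
Lemma pt_inj : injective pt_fun.
Proof.
move=> a b /(congr1 val); rewrite /= !inordK ?ltn_mod // => E.
by apply: val_inj => /=; have := ltn_ord a; have := ltn_ord b; lia.
Qed.
Let pf (x : bool) : {perm 'I_7} := if x then perm ps_inj else perm pt_inj.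

Lemma frobenius21_perm_rel u v :
  frobenius_rel u v -> eval_word pf u = eval_word pf v.
Proof.
case; rewrite /eval_word /= !big_cons big_nil /eval_letter /= !mulg1;
  try apply: (mulIg (perm ps_inj)); rewrite -?mulgA ?mulVg ?mulg1 ?mul1g;
  apply/permP => a; rewrite !permM !permE ?perm1; apply: val_inj;
  rewrite /= /ps_fun /pt_fun ?inordK ?ltn_mod //; have := ltn_ord a; lia.
Qed.

Lemma nf_inj : injective nf.
Proof.
pose phi := pres_hom frobenius21_perm_rel.
have phiM : {morph phi : a b / a * b} by exact: pres_hom_morph.
have phiX a k : phi (a ^+ k) = phi a ^+ k.
  elim: k => [|k IH]; last by rewrite !expgS phiM IH.
  by rewrite !expg0; apply: (mulgI (phi 1)); rewrite -phiM !mulg1.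
have ptX k (a : 'I_7) : (perm pt_inj ^+ k) a = (a + k) %% 7 :> nat.
  elim: k a => [|k IH] a.
    by rewrite expg0 perm1 addn0 modn_small.
  rewrite expgS permM IH permE /pt_fun inordK ?ltn_mod //; lia.
have psX k (a : 'I_7) : (perm ps_inj ^+ k) a = (a * 4 ^ k) %% 7 :> nat.
  elim: k a => [|k IH] a.
    by rewrite expg0 perm1 muln1 modn_small.
  by rewrite expgS permM IH permE /ps_fun inordK ?ltn_mod // expnS mulnA modnMml.
have E j i (a : 'I_7) : phi (nf (j, i)) a = ((a + j) * 4 ^ i) %% 7 :> nat.
  rewrite /nf phiM !phiX /phi /s /t !pres_hom_gen /= permM psX ptX.
  by rewrite modnMml.
move=> [j i] [j' i'] eqn.
have e0 := E j i (inord 0); have e1 := E j i (inord 1).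
rewrite eqn !E !inordK // in e0 e1.
case: j j' i i' {eqn E} e0 e1 => [j jl] [j' jl'] [i il] [i' il'] /= e0 e1.
by move: il il' e0 e1; case: i => [|[|[|//]]] il; case: i' => [|[|[|//]]] il';
  rewrite ?expn0 ?expn1 ?(erefl : 4 ^ 2 = 16) => e0 e1;
  (try by exfalso; lia); congr (_, _); apply: val_inj => /=; lia.
Qed.

Lemma frobenius21_card : ([set: frobenius21] #= `I_21)%card.
Proof.
have E : #|{: 'I_7 * 'I_3}| = 21 by rewrite card_prod !card_ord.
rewrite card_eq_sym -E; apply: card_eq_trans card_II _.
have [f] : $|{bij [set: 'I_#|{: 'I_7 * 'I_3}|] >-> [set: frobenius21]}|.
  apply/bijPex; exists (nf \o enum_val); split=> //.
    by move=> x y _ _ /nf_inj /enum_val_inj.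
  move=> a _; have [k ->] := nf_surj a.
  by exists (enum_rank k); rewrite //= enum_rankK.
exact: pcard_eq f.
Qed.

End FrobeniusOrder.

(* Main.v *)
(* In B_n / [P_n, P_n] conjugates of squares of generators commute.  They are
   the classes A_ij of the standard generators of P_n, and conjugation by sigma_k
   permutes them as the transposition (k k+1) permutes pairs of strands.  So
   every word can be rewritten as a product of A_ij^(+-1) followed by a positive
   normal form of its permutation, and it is trivial as soon as the exponents of
   the A_ij cancel and the normal form is empty.

   The group of order 21 acts regularly on the 21 pairs of points of Z/7, so the
   permutation module Z^21 is free over it and its preimage in the quotient
   splits: s and t lift to elements satisfying the defining relations.
   Injectivity is already visible in the permutations. *)

Require Import Defs.
From mathcomp Require Import all_boot all_classical.
From mathcomp Require Import perm zify.

Set Implicit Arguments.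
Unset Strict Implicit.
Unset Printing Implicit Defensive.

Local Open Scope group_scope.

(** * Rewriting braid words by normal forms of permutations *)

Definition swap (k i : nat) : nat :=
  if i == k then k.+1 else if i == k.+1 then k else i.

(* The action of (k k+1) on pairs i < j, keeping them ordered. *)
Definition swap_pair (k : nat) (p : nat * nat) : nat * nat :=
  if p == (k, k.+1) then p else (swap k p.1, swap k p.2).

(* A normal form of a permutation of {0, .., n} is given by a list ms of size n:
   an entry m followed by r entries stands for the block
   sigma_r sigma_(r-1) .. sigma_m, which is empty if m = r + 1, and the block of
   the head of the list is the last factor of the word. *)
Definition block (m r : nat) : seq nat := rev (iota m (r.+1 - m)).

Fixpoint nf_word (ms : seq nat) : seq nat :=
  if ms is m :: ms' then nf_word ms' ++ block m (size ms') else [::].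

Fixpoint nf_wf (ms : seq nat) : bool :=
  if ms is m :: ms' then (m <= (size ms').+1) && nf_wf ms' else true.

(** Every entry is one more than the number of entries after it, so all blocks are empty. *)
Fixpoint nf_one (n : nat) : seq nat :=
  if n is n'.+1 then n :: nf_one n' else [::].

(* Multiplies a normal form by sigma_j on the right; the first component is the
   pair of a square pulled out to the left, if one appears. *)
Fixpoint nf_insert (j : nat) (ms : seq nat) : seq (nat * nat) * seq nat :=
  if ms is m :: ms' then
    if j.+1 < m then let: (a, t) := nf_insert j ms' in (a, m :: t)
    else if j.+1 == m then ([::], j :: ms')
    else if j == m then
      ([:: foldr swap_pair (m, m.+1) (nf_word (m.+1 :: ms'))], m.+1 :: ms')
    else let: (a, t) := nf_insert j.-1 ms' in (a, m :: t)
  else ([::], [::]).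

(* An inverse letter is read as sigma_k^-1 = sigma_k^-2 sigma_k. *)
Fixpoint collect (pos neg : seq (nat * nat)) (ms : seq nat) (w : word nat) :
    seq (nat * nat) * seq (nat * nat) * seq nat :=
  if w is (k, b) :: w' then
    let: (a, t) := nf_insert k ms in
    let neg' :=
      if b then neg else foldr swap_pair (k, k.+1) (nf_word ms) :: neg in
    collect (a ++ pos) neg' t w'
  else (pos, neg, ms).

Definition trivial_word (n : nat) (w : word nat) : bool :=
  let: (pos, neg, ms) := collect [::] [::] (nf_one n) w in
  perm_eq pos neg && (nf_word ms == [::]).

Lemma perm_prodg (G : groupType) (I : eqType) (f : I -> G) (s1 s2 : seq I) :
  (forall i j, commute (f i) (f j)) -> perm_eq s1 s2 ->
  \prod_(i <- s1) f i = \prod_(i <- s2) f i.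
Proof.
move=> fC; elim: s1 s2 => [|i s1 IH] s2 e.
  by rewrite perm_sym in e; rewrite (perm_nilP e).
have : i \in s2 by rewrite -(perm_mem e) mem_head.
move=> /splitPr s2E; case: s2 / s2E e => u v e.
have /IH e1 : perm_eq s1 (u ++ v).
  by rewrite -(perm_cons i) (perm_trans e) // -cat1s perm_catCA.
rewrite big_cons e1 !big_cat big_cons /= !mulgA; congr (_ * _).
by apply: commute_prod => j _; exact: fC.
Qed.

Lemma conjg_commute (G : groupType) (g h : G) : commute g h -> g ^ h = g.
Proof. by move=> gh; rewrite conjgE gh mulKg. Qed.

(** * Groups with braid relations in which conjugates of squares commute *)

Section AbelianSquares.
Variables (G : groupType) (n : nat) (x : nat -> G).

Hypothesis x_far : forall i j, i.+1 < j < n -> commute (x i) (x j).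
Hypothesis x_near : forall i, i.+1 < n ->
  x i.+1 * x i * x i.+1 = x i * x i.+1 * x i.
Hypothesis x_sq : forall i j g h,
  commute ((x i ^+ 2) ^ g) ((x j ^+ 2) ^ h).

(** The standard pure braid generator A_ij for (i, j) = [p]. Here [n] counts the generators, so
    strands are numbered from 0 to [n]. *)
Definition pure_gen (p : nat * nat) : G :=
  (x p.1 ^+ 2) ^ \prod_(p.1.+1 <= k < p.2) x k.

Lemma pure_genC p q : commute (pure_gen p) (pure_gen q).
Proof. exact: x_sq. Qed.

Lemma pure_gen_next i : pure_gen (i, i.+1) = x i ^+ 2.
Proof. by rewrite /pure_gen big_geq // conjg1. Qed.

Lemma pure_genS i j : i < j -> pure_gen (i, j.+1) = pure_gen (i, j) ^ x j.
Proof. by move=> ij; rewrite /pure_gen big_nat_recr //= conjgM. Qed.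

(** The square of [x k] commutes with every A_ij, so a letter and its inverse act alike on them. *)
Lemma pure_genJK p k : (pure_gen p ^ x k) ^ x k = pure_gen p.
Proof.
rewrite -(conjgM (pure_gen p)); apply: conjg_commute.
by have := x_sq p.1 k (\prod_(p.1.+1 <= l < p.2) x l) 1; rewrite conjg1 expg2.
Qed.

(* Otherwise rewriting with mulgA unfolds pure_gen to match a product. *)
Local Opaque pure_gen.

Lemma conjgAC_commute (a g h : G) : commute g h -> (a ^ g) ^ h = (a ^ h) ^ g.
Proof. by move=> gh; rewrite -!conjgM gh. Qed.

Lemma x_commute i j : i < n -> j < n -> (i.+1 < j) || (j.+1 < i) ->
  commute (x i) (x j).
Proof.
by move=> ? ? /orP[?|?]; [|apply: commute_sym]; apply: x_far; lia.
Qed.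

Lemma pure_genJ_far i j k : i < j <= n -> k < n -> (k.+1 < i) || (j < k) ->
  pure_gen (i, j) ^ x k = pure_gen (i, j).
Proof.
elim: j => [|j IH] ijn kn f; first by lia.
have [eij|nij] := eqVneq i j.
  rewrite -eij pure_gen_next; apply: conjg_commute; apply/commute_sym/commuteX.
  by apply: x_commute; lia.
rewrite pure_genS; last lia.
rewrite (conjgAC_commute _ (h := x k)) ?IH //; try lia.
by apply: x_commute; lia.
Qed.

(** In the first case, j = k + 2, A_ij is A_ik conjugated by x_k x_(k+1). Then x_k x_(k+1) x_k =
    x_(k+1) x_k x_(k+1) applies, and x_(k+1) fixes A_ik. *)
Lemma pure_genJ_mid i j k : i < k -> k.+1 < j <= n ->
  pure_gen (i, j) ^ x k = pure_gen (i, j).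
Proof.
move=> ik; elim: j => [|j IH] kj; first by lia.
have [ejk|nkj] := eqVneq j k.+1.
  rewrite ejk !pure_genS; try lia.
  rewrite -!(conjgM (pure_gen _)) -x_near; last lia.
  by rewrite !(conjgM (pure_gen _)) pure_genJ_far //; lia.
rewrite pure_genS; last lia.
rewrite (conjgAC_commute _ (h := x k)) ?IH //; try lia.
by apply: x_commute; lia.
Qed.

(** In the first case, j = i + 2, the braid relation says that x_(i+1) x_i conjugates x_i to
    x_(i+1). *)
Lemma pure_genJ_lo i j : i.+1 < j <= n ->
  pure_gen (i, j) ^ x i = pure_gen (i.+1, j).
Proof.
elim: j => [|j IH] ij; first by lia.
have [eij|nij] := eqVneq j i.+1.
  rewrite eij pure_genS // !pure_gen_next -conjgM conjXg; congr (_ ^+ 2).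
  apply: (mulgI (x i.+1 * x i)).
  by rewrite conjgE mulVKg mulgA x_near //; lia.
rewrite pure_genS; last lia.
rewrite (conjgAC_commute _ (h := x i)) ?IH ?pure_genS //; try lia.
by apply: x_commute; lia.
Qed.

(** Moving an end of the pair from k + 1 down to k undoes the opposite move, by [pure_genJK]. *)
Lemma pure_genJ p k : p.1 < p.2 <= n -> k < n ->
  pure_gen p ^ x k = pure_gen (swap_pair k p).
Proof.
case: p => i j /= ijn kn; rewrite /swap_pair /swap xpair_eqE /=.
have [eik|nik] := eqVneq i k; have [ejk|njk] := eqVneq j k.+1 => /=.
- by rewrite eik ejk pure_gen_next conjXg conjgE mulKg.
- by subst k; rewrite [j == i]gtn_eqF ?pure_genJ_lo //; lia.
- rewrite ltn_eqF ?[j == k]gtn_eqF ?ejk; try lia.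
  by rewrite pure_genS ?pure_genJK //; lia.
have [eik1|nik1] := eqVneq i k.+1;
  have [ejk1|njk1] := eqVneq j k => //=; try lia.
- by rewrite eik1 -pure_genJ_lo ?pure_genJK //; lia.
- by rewrite ejk1 pure_genS //; lia.
have [?|?] : (k.+1 < i) || (j < k) \/ i < k /\ k.+1 < j by lia.
- by rewrite pure_genJ_far //; lia.
- by rewrite pure_genJ_mid //; lia.
Qed.

Lemma gen_pure p k : p.1 < p.2 <= n -> k < n ->
  x k * pure_gen p = pure_gen (swap_pair k p) * x k.
Proof.
(* Passing [x k] to the right conjugates by its inverse, which acts as [x k] does. *)
by move=> pn kn; rewrite -pure_genJ // -[in LHS](pure_genJK p k) -conjgC.
Qed.

Lemma swap_pair_wf k p : p.1 < p.2 <= n -> k < n ->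
  (swap_pair k p).1 < (swap_pair k p).2 <= n.
Proof.
case: p => i j /=; rewrite /swap_pair xpair_eqE /swap => ijn kn.
case: ifP => //= e; do ![case: eqVneq => ? //=]; lia.
Qed.

Lemma foldr_swap_pair_wf u p : p.1 < p.2 <= n -> all (ltn^~ n) u ->
  (foldr swap_pair p u).1 < (foldr swap_pair p u).2 <= n.
Proof.
by move=> pn; elim: u => //= k u IH /andP[kn /IH] ?; exact: swap_pair_wf.
Qed.

Local Notation prod_word u := (\prod_(k <- u) x k).
Local Notation prod_pure s := (\prod_(p <- s) pure_gen p).

Lemma prod_word_pure u p : p.1 < p.2 <= n -> all (ltn^~ n) u ->
  prod_word u * pure_gen p = pure_gen (foldr swap_pair p u) * prod_word u.
Proof.
move=> pn; elim: u => [|k u IH] /=; first by rewrite big_nil mul1g mulg1.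
case/andP=> kn un; rewrite big_cons -mulgA IH // [LHS]mulgA [RHS]mulgA.
by rewrite gen_pure // foldr_swap_pair_wf.
Qed.

Lemma commute_word u k :
  all (fun i => (i < n) && ((k.+1 < i) || (i.+1 < k))) u -> k < n ->
  commute (x k) (prod_word u).
Proof.
elim: u => [|i u IH] /=; first by rewrite big_nil => _ _; exact: commute1.
case/andP=> /andP[iN ik] un kn; rewrite big_cons; apply: commuteM (IH un kn).
exact: x_commute.
Qed.

Lemma block_ltn m r : all (fun k => m <= k <= r) (block m r).
Proof. by rewrite /block all_rev; apply/allP => k; rewrite mem_iota; lia. Qed.

(** Going left, x_j passes the letters below j - 1, becomes x_(j-1) by x_j x_(j-1) x_j = x_(j-1) x_j
    x_(j-1), and then passes the letters above j. *)
Lemma block_above m r j : m < j <= r -> j <= r < n ->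
  prod_word (block m r) * x j = x j.-1 * prod_word (block m r).
Proof.
move=> mj jr.
have -> : block m r = block j.+1 r ++ [:: j; j.-1] ++ rev (iota m (j.-1 - m)).
  rewrite /block -[[:: j; _]]/(rev [:: j.-1; j]) -!rev_cat; congr rev.
  rewrite (_ : r.+1 - m = (j.-1 - m) + (2 + (r.+1 - j.+1))); last lia.
  by rewrite !iotaD /= -catA /=; congr (_ ++ [:: _, _ & iota _ _]); lia.
rewrite !big_cat !big_cons big_nil /= mulg1.
have comm_lo : commute (x j) (prod_word (rev (iota m (j.-1 - m)))).
  by apply: commute_word; [apply/allP => i; rewrite mem_rev mem_iota; lia|lia].
have comm_hi : commute (x j.-1) (prod_word (block j.+1 r)).
  by apply: commute_word; [apply: sub_all (block_ltn _ _) => i /=; lia|lia].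
rewrite -!mulgA -comm_lo !mulgA comm_hi -!mulgA; congr (_ * _).
rewrite !mulgA; congr (_ * _); have := @x_near j.-1.
by rewrite prednK; [apply; lia|lia].
Qed.

Lemma blockS m r : m <= r -> block m r = block m.+1 r ++ [:: m].
Proof.
move=> mr; rewrite /block (_ : r.+1 - m = (r - m).+1); last lia.
by rewrite rev_cons cats1.
Qed.

Lemma nf_word_ltn ms : nf_wf ms -> size ms <= n -> all (ltn^~ n) (nf_word ms).
Proof.
elim: ms => //= m ms IH /andP[_ wf] sz; rewrite all_cat IH //; last lia.
by apply: sub_all (block_ltn _ _) => k /=; lia.
Qed.

(** The new letter commutes with the last block (j + 1 < m), extends it (j + 1 = m), forms a square
    with its last letter that moves left as some A_ij (j = m), or passes it as x_(j-1) (j > m). *)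
Lemma nf_insertP j ms : nf_wf ms -> j < size ms <= n ->
  [/\ nf_wf (nf_insert j ms).2, size (nf_insert j ms).2 = size ms &
    prod_word (nf_word ms) * x j =
    prod_pure (nf_insert j ms).1 * prod_word (nf_word (nf_insert j ms).2)].
Proof.
elim: ms j => //= m ms IH j /andP[mr wf] jr.
have [jm|mj|mj] := ltngtP j.+1 m.
- have jms : j < size ms <= n by lia.
  case: (nf_insert j ms) (IH j wf jms) => a t /= [-> -> e]; split=> //.
    by rewrite mr.
  rewrite !big_cat /= mulgA -e -!mulgA; congr (_ * _).
  apply/commute_sym/commute_word; last lia.
  by apply: sub_all (block_ltn _ _) => k /=; lia.
- have [jm|jm] := eqVneq j m.
    subst j; split => //=; first by rewrite wf andbT; lia.
    rewrite big_seq1 -prod_word_pure /=; [|lia|].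
      rewrite pure_gen_next blockS; last lia.
      by rewrite catA big_cat big_seq1 /= -mulgA expg2.
    rewrite all_cat nf_word_ltn //; last lia.
    by apply: sub_all (block_ltn _ _) => k /=; lia.
  have jms : j.-1 < size ms <= n by lia.
  case: (nf_insert j.-1 ms) (IH j.-1 wf jms) => a t /= [-> -> e]; split=> //.
    by rewrite mr.
  by rewrite !big_cat /= mulgA -e -!mulgA block_above //; lia.
- split; rewrite //= ?wf ?andbT; first lia.
  rewrite big_nil mul1g (blockS (m := j)) -?mj; last lia.
  by rewrite !big_cat /= big_seq1 mulgA.
Qed.

(** This is the loop invariant. Since all A_ij commute, those just pulled out may join either list
    at any place. *)
Lemma collectP pos neg ms w pos' neg' ms' :
  nf_wf ms -> size ms = n -> all (fun l => l.1 < n) w ->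
  collect pos neg ms w = (pos', neg', ms') ->
  prod_pure pos * (prod_pure neg)^-1 * prod_word (nf_word ms) * eval_word x w =
  prod_pure pos' * (prod_pure neg')^-1 * prod_word (nf_word ms').
Proof.
elim: w pos neg ms => [|[k b] w IH] pos neg ms wf sz.
  by move=> _ [<- <- <-]; rewrite /eval_word big_nil mulg1.
case/andP=> /= kn wn.
have ksz : k < size ms <= n by rewrite sz leqnn andbT.
case: (nf_insert k ms) (nf_insertP wf ksz) => a t /= [twf tsz e].
rewrite sz in tsz.
have -> : eval_word x ((k, b) :: w) = eval_word x [:: (k, b)] * eval_word x w.
  exact: (eval_word_cat x [:: _]).
set neg1 := if b then _ else _ => E; rewrite [LHS]mulgA.
rewrite (_ : _ * eval_word x [:: _] =
    prod_pure (a ++ pos) * (prod_pure neg1)^-1 * prod_word (nf_word t)).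
  exact: IH E.
have pureC u v : commute (prod_pure u) (prod_pure v).
  apply: commute_prod => p _; apply/commute_sym/commute_prod => q _.
  exact: pure_genC.
have insertE s :
    prod_pure pos * (prod_pure s)^-1 * prod_word (nf_word ms) * x k =
    prod_pure (a ++ pos) * (prod_pure s)^-1 * prod_word (nf_word t).
  rewrite -[LHS]mulgA e [LHS]mulgA; congr (_ * _); rewrite big_cat /=.
  rewrite -[LHS]mulgA -(commuteV (pureC a s)) mulgA; congr (_ * _).
  exact: pureC.
rewrite /eval_word big_seq1 /eval_letter /neg1 /=; case: b {neg1 E} => //.
have -> : (x k)^-1 = (x k ^+ 2)^-1 * x k.
  by rewrite expg2 invgM -mulgA mulVg mulg1.
have W : prod_word (nf_word ms) * (x k ^+ 2)^-1 =
    (pure_gen (foldr swap_pair (k, k.+1) (nf_word ms)))^-1 *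
    prod_word (nf_word ms).
  apply: (mulIg (x k ^+ 2)); rewrite -mulgA mulVg mulg1 -mulgA -pure_gen_next.
  rewrite prod_word_pure ?nf_word_ltn ?sz // ?mulKg //=; lia.
set p := foldr _ _ _ in W *.
rewrite -(insertE (p :: neg)) big_cons (invgM (pure_gen p)).
by rewrite [LHS]mulgA -[X in X * x k]mulgA W !mulgA.
Qed.

Lemma nf_oneP k :
  [/\ nf_wf (nf_one k), size (nf_one k) = k & nf_word (nf_one k) = [::]].
Proof.
by elim: k => //= k [-> -> ->]; rewrite /block subnn leqnn.
Qed.

Lemma trivial_wordP w : all (fun l => l.1 < n) w -> trivial_word n w ->
  eval_word x w = 1.
Proof.
rewrite /trivial_word => wn; have [wf sz e] := nf_oneP n.
case E: (collect _ _ _ _) => [[pos neg] ms].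
have := collectP wf sz wn E; rewrite e !big_nil invg1 !mul1g => ->.
case/andP=> pn /eqP->; rewrite big_nil mulg1 (perm_prodg _ pn) ?mulgV //.
exact: pure_genC.
Qed.

End AbelianSquares.

Lemma eval_word_winv (X : choiceType) (G : groupType) (f : X -> G) w :
  eval_word f (winv w) = (eval_word f w)^-1.
Proof.
elim: w => [|[k b] w IH]; first by rewrite /eval_word big_nil invg1.
rewrite -cat1s /winv map_cat rev_cat !eval_word_cat IH invgM; congr (_ * _).
by rewrite /eval_word !big_seq1; case: b; rewrite /eval_letter ?invgK.
Qed.

Lemma pclass_nseq (X : choiceType) (R : word X -> word X -> Prop) (k : X) m :
  pclass R (nseq m (gen k)) = pgen R k ^+ m.
Proof. by elim: m => // m IH; rewrite expgS -IH -pclassM. Qed.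

(** Permutations thus detect nontrivial classes in the quotient. *)
Lemma derived_pure_braid_sub n (a : braid_group n) :
  nsub (derived_pure_braid n) a -> braid_perm a = 1.
Proof.
move=> Da; apply: (Da _ (pure_braid_subgroup _)) => _ [y Py [z Pz <-]].
have [_ PM PV] := pure_braid_subgroup n.
exact: PM (PV _ Py) (pure_braid_normal _ Py).
Qed.

(** * Computing in the quotient by the commutator subgroup of pure braids *)

Section PureAbelianisation.

Variable n : nat.
Local Notation Q := (quot (derived_pure_braid n.+2)).

(** Plain numbers as indices keep words computable; by [inord], an index above [n] denotes generator
    0. *)
Definition bgen (k : nat) : braid_group n.+2 := braid_gen (n := n.+2) (inord k).
Definition qgen (k : nat) : Q := qclass (derived_pure_braid n.+2) (bgen k).

Lemma qclass_eval w : eval_word qgen w = qclass _ (eval_word bgen w).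
Proof.
elim: w => [|[k b] w IH]; first by rewrite /eval_word !big_nil.
rewrite -cat1s !eval_word_cat qclassM IH; congr (_ * _).
rewrite /eval_word !big_seq1 /eval_letter; case: b => //=.
exact: quot_invE.
Qed.

Lemma bgen_far i j : i.+1 < j < n.+1 -> commute (bgen i) (bgen j).
Proof.
move=> ij.
have := pres_gen_rel (braid_far (i := inord i : 'I_n.+2.-1) (j := inord j) _).
rewrite /eval_word !big_cons big_nil !mulg1; apply.
by rewrite !inordK; lia.
Qed.

Lemma bgen_near i : i.+1 < n.+1 ->
  bgen i.+1 * bgen i * bgen i.+1 = bgen i * bgen i.+1 * bgen i.
Proof.
move=> i_n.
have := pres_gen_rel
  (braid_near (i := inord i : 'I_n.+2.-1) (j := inord i.+1) _).
rewrite /eval_word !big_cons big_nil !mulg1 !mulgA; apply.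
by rewrite !inordK; lia.
Qed.

Lemma qgen_sq i j (g h : Q) : commute ((qgen i ^+ 2) ^ g) ((qgen j ^+ 2) ^ h).
Proof.
rewrite -(qclass_repr g) -(qclass_repr h); set g' := repr g; set h' := repr h.
have E k (a : braid_group n.+2) :
    (qgen k ^+ 2) ^ qclass (derived_pure_braid n.+2) a =
    qclass _ ((bgen k ^+ 2) ^ a).
  by rewrite !conjgE !qclassM -[in RHS]quot_invE.
have P k (a : braid_group n.+2) : pure_braid ((bgen k ^+ 2) ^ a).
  apply: pure_braid_normal; rewrite /pure_braid /= expg2 braid_permM.
  by rewrite braid_perm_gen tperm2.
rewrite /commute !E -!qclassM; apply/qclassP; apply: sub_generated.
(* Equality of the classes of u v and v u asks for (u v)^-1 v u = [v, u], so the conjugate for [j]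
   comes first. *)
exists ((bgen j ^+ 2) ^ h'); first exact: P.
exists ((bgen i ^+ 2) ^ g'); first exact: P.
by rewrite /commg /conjg !invgM !mulgA.
Qed.

Lemma qgen_trivial w : all (fun l => l.1 < n.+1) w -> trivial_word n.+1 w ->
  eval_word qgen w = 1.
Proof.
apply: trivial_wordP => [i j ij|i i_n|]; last exact: qgen_sq.
  by rewrite /commute -!qclassM bgen_far.
have := congr1 (qclass (derived_pure_braid n.+2)) (bgen_near i_n).
by rewrite !qclassM.
Qed.

(** Signs of letters drop out because transpositions are involutions. *)
Lemma braid_perm_eval w (i : 'I_n.+2) : all (fun l => l.1 < n.+1) w ->
  braid_perm (eval_word bgen w) i = foldl (fun j l => swap l.1 j) i w :> nat.
Proof.
elim: w i => [|[k b] w IH] i.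
  by rewrite /eval_word big_nil braid_perm1 perm1.
case/andP=> /= kn /IH {}IH; rewrite -cat1s eval_word_cat braid_permM permM IH.
congr foldl; rewrite /eval_word big_seq1 /eval_letter /=.
have -> : braid_perm (if b then bgen k else (bgen k)^-1) =
    braid_transp (n := n.+2) (inord k).
  by case: b; rewrite ?braid_permV braid_perm_gen ?tpermV.
rewrite /braid_transp /swap; case: tpermP => [->|->|/eqP lo /eqP hi].
- by rewrite /= inordK // eqxx.
- by rewrite /= inordK // eqxx gtn_eqF.
by rewrite -!val_eqE /= !inordK // in lo hi; rewrite (negPf lo) (negPf hi).
Qed.

End PureAbelianisation.

(** * Lifting the Frobenius group to braids on seven strands *)

(* The signs were found by a search: in the preimage of F each pair of strands
   has to have total crossing number 0 in every relator. *)
Definition frob_word (b : bool) : word nat :=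
  (if b then [:: (5, true); (3, true); (4, false);
                 (1, true); (2, false); (3, false)]
   else [:: (0, true); (1, true); (2, false);
            (3, true); (4, false); (5, false)])%N.

Definition frob_subst (w : word bool) : word nat :=
  flatten [seq if l.2 then frob_word l.1 else winv (frob_word l.1) | l <- w].

Lemma eval_frob_subst (G : groupType) (f : nat -> G) w :
  eval_word (fun b => eval_word f (frob_word b)) w = eval_word f (frob_subst w).
Proof.
elim: w => [|[k b] w IH]; first by rewrite /eval_word !big_nil.
rewrite /frob_subst /= eval_word_cat -[flatten _]/(frob_subst w) -IH -cat1s.
rewrite eval_word_cat [X in X * _ = _]/eval_word big_seq1; congr (_ * _).
by case: b => //; rewrite eval_word_winv.
Qed.

Lemma frob_word_rel u v : frobenius_rel u v ->
  eval_word (fun b => eval_word (qgen 5) (frob_word b)) u =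
  eval_word (fun b => eval_word (qgen 5) (frob_word b)) v.
Proof.
move=> uv.
(* Each relation u = v becomes a single braid word for u v^-1, which [trivial_word] can test. *)
apply: (mulIg (eval_word (fun b => eval_word (qgen 5) (frob_word b)) v)^-1).
rewrite mulgV -eval_word_winv -eval_word_cat eval_frob_subst.
by case: uv; apply: qgen_trivial; vm_compute.
Qed.

Definition frob_embed : frobenius21 -> quot (derived_pure_braid 7) :=
  pres_hom frob_word_rel.

Lemma frob_embedM : {morph frob_embed : a b / a * b}.
Proof. exact: pres_hom_morph. Qed.

Lemma frob_subst_ltn w : all (fun l => l.1 < 6) (frob_subst w).
Proof.
elim: w => [|[k b] w IH] //; rewrite /frob_subst /= all_cat IH andbT.
by case: k; case: b.
Qed.

Definition letters_act (w : word nat) (i : nat) : nat :=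
  foldl (fun j l => swap l.1 j) i w.

(** On Z/7 the word for t acts as a -> a - 1 and the one for s as a -> 4 a. So t^j s^i is the affine
    map a -> 4^i (a - j), determined by its values at 0 and 1; the 21 cases are computed. *)
Lemma frob_subst_faithful (j : 'I_7) (i : 'I_3) :
  let w := frob_subst (nseq j (gen frob_t) ++ nseq i (gen frob_s)) in
  letters_act w 0 = 0%N -> letters_act w 1 = 1%N ->
  (j = 0 :> nat)%N /\ (i = 0 :> nat)%N.
Proof.
pose P j' i' :=
  let w := frob_subst (nseq j' (gen frob_t) ++ nseq i' (gen frob_s)) in
  ((letters_act w 0 == 0) && (letters_act w 1 == 1) ==>
     (j' == 0) && (i' == 0))%N.
have /allP/(_ (nat_of_ord j)) :
    all (fun j' => all (P j') (iota 0 3)) (iota 0 7).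
  by vm_compute.
rewrite mem_iota ltn_ord => /(_ isT)/allP/(_ (nat_of_ord i)).
rewrite mem_iota ltn_ord => /(_ isT)/implyP h w a0 a1.
by move: h; rewrite -/w a0 a1 !eqxx => /(_ isT)/andP[/eqP-> /eqP->].
Qed.

Lemma frob_embed_ker a : frob_embed a = 1 -> a = 1.
Proof.
have [[j i] /= ->] := nf_surj a.
rewrite -!pclass_nseq -pclassM /frob_embed pres_hom_pclass eval_frob_subst.
have := @frob_subst_faithful j i; set w := frob_subst _ => /= faithful.
rewrite qclass_eval -[1 in X in X -> _]/(qclass _ 1).
move/esym/qclassP/derived_pure_braid_sub; rewrite invg1 mul1g => p1.
have act_id (l : 'I_7) : letters_act w l = l.
  by rewrite /letters_act -braid_perm_eval ?frob_subst_ltn // p1 perm1.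
have [||-> ->] := faithful; last by [].
  by have := act_id (inord 0%N); rewrite inordK.
by have := act_id (inord 1%N); rewrite inordK.
Qed.

Theorem theorem7 :
  exists2 H : set (quot (derived_pure_braid 7)),
    is_subgroup H & isomorphic_to frobenius21 H.
Proof.
have f1 : frob_embed 1 = 1.
  by apply: (mulgI (frob_embed 1)); rewrite -frob_embedM !mulg1.
have fV a : frob_embed a^-1 = (frob_embed a)^-1.
  by apply: (mulgI (frob_embed a)); rewrite -frob_embedM !mulgV.
exists (range frob_embed).
  split=> [|_ _ [a _ <-] [b _ <-]|_ [a _ <-]]; first by exists 1.
    by exists (a * b); rewrite ?frob_embedM.
  by exists a^-1.
exists frob_embed; first exact: frob_embedM.
split=> // a b _ _ fab.
apply: (mulIg b^-1); rewrite mulgV; apply: frob_embed_ker.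
by rewrite frob_embedM fV fab mulgV.
Qed.
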